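(* Let $n \ge 2$ be an integer and let $G = G_{2^n+1,2}$. For a vertex $v \in V(G)$, we have $\chi(G - v) < \chi(G)$ if and only if $v \in W$, where \[ W = \{(x,y) : 1 \le x < y \le 2^n+1 \text{ and } \{x,y\} \subseteq I_\ell \text{ for some } \ell \in \{0,1,\dots,n\}\}, \] and $I_\ell = [\,2^\ell,\; 2^n - 2^{n-\ell} + 2\,]$ for $0 \le \ell \le n$.
   Context: For integers $p \le q$, $[p,q]$ denotes $\{p,p+1,\dots,q\}$. For an integer $N \ge 5$, the shift graph $G_{N,2}$ has as vertices the ordered pairs $(x,y)$ of integers with $1 \le x < y \le N$, and two vertices $(x,y)$ and $(y,z)$ are adjacent whenever $x<y<z$ (these are the only edges). $G - v$ denotes the graph obtained by deleting the vertex $v$. *)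

(* Defs.v *)
From mathcomp Require Import all_boot.

Set Implicit Arguments.
Unset Strict Implicit.
Unset Printing Implicit Defensive.

Record sgraph := SGraph {
  vertex :> finType;
  adj : rel vertex;
  adj_sym : symmetric adj;
  adj_irrefl : irreflexive adj
}.

Definition proper_coloring (G : sgraph) (k : nat) (c : {ffun G -> 'I_k}) : bool :=
  [forall x, forall y, adj x y ==> (c x != c y)].

Definition colorable (G : sgraph) (k : nat) : bool :=
  [exists c : {ffun G -> 'I_k}, proper_coloring c].

Lemma exists_colorable (G : sgraph) : exists k, colorable G k.
Proof.
exists #|G|; apply/existsP; exists [ffun x => enum_rank x].
apply/forallP => x; apply/forallP => y; apply/implyP; rewrite !ffunE.
by apply: contraTneq => /enum_rank_inj ->; rewrite adj_irrefl.
Qed.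

Definition chi (G : sgraph) : nat := ex_minn (exists_colorable G).

Section DeleteVertex.
Variables (G : sgraph) (v : G).

Definition del_adj : rel {x : G | x != v} := fun x y => adj (val x) (val y).

Lemma del_adj_sym : symmetric del_adj.
Proof. by move=> x y; apply: adj_sym. Qed.

Lemma del_adj_irrefl : irreflexive del_adj.
Proof. by move=> x; apply: adj_irrefl. Qed.

Definition del_vertex : sgraph := SGraph del_adj_sym del_adj_irrefl.
End DeleteVertex.

Section ShiftGraph.
Variable N : nat.

(* 'I_N.+1 is {0, ..., N}; the value 0 is excluded by the first conjunct. *)
Definition shift_vertex : finType :=
  {p : 'I_N.+1 * 'I_N.+1 | (0 < p.1) && (p.1 < p.2)}.

Definition vfst (u : shift_vertex) : nat := (val u).1.
Definition vsnd (u : shift_vertex) : nat := (val u).2.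

(* The inequalities x < y < z of an edge (x, y) -- (y, z) are carried by the
   vertices. *)
Definition shift_adj : rel shift_vertex :=
  fun u w => (vsnd u == vfst w) || (vsnd w == vfst u).

Lemma shift_adj_sym : symmetric shift_adj.
Proof. by move=> u w; rewrite /shift_adj orbC. Qed.

Lemma shift_adj_irrefl : irreflexive shift_adj.
Proof.
move=> u; rewrite /shift_adj orbb; case/andP: (valP u) => _ lt_u.
exact: gtn_eqF lt_u.
Qed.

Definition shift_graph : sgraph := SGraph shift_adj_sym shift_adj_irrefl.
End ShiftGraph.

Definition interval (p q : nat) : {pred nat} := [pred k | p <= k <= q].

(* The truncated subtraction is exact, since 2 ^ (n - l) <= 2 ^ n. *)
Definition I_ (n l : nat) : {pred nat} :=
  interval (2 ^ l) (2 ^ n - 2 ^ (n - l) + 2).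

Definition W (n : nat) : {set shift_graph (2 ^ n + 1)} :=
  [set v | [exists l : 'I_n.+1, (vfst v \in I_ n l) && (vsnd v \in I_ n l)]].

(* Main.v *)
Require Import Defs.
From mathcomp Require Import all_boot.
From mathcomp Require Import zify.

(** A proper [k]-coloring of a set of pairs [(x, y)] of the shift graph amounts
    to a family [S] of subsets of the [k] colors with [S x] not included in
    [S y] for every pair: take for [S x] the colors of the pairs starting at
    [x].  For [2 ^ n + 1] integers and [n] colors, when only the pair [(a, b)]
    is dropped, counting forces [S a = S b =: T], every strict superset of [T]
    to occur before [a] and every strict subset of [T] after [b]; this gives
    [2 ^ l <= a] and [b <= 2 ^ n - 2 ^ (n - l) + 2] with [l = n - #|T|].
    Conversely, under these bounds a family is obtained by listing the strict
    supersets of [T], then the sets incomparable with [T] by decreasing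
    cardinality with two copies of [T] inserted at [a] and [b], and then the
    strict subsets of [T]. *)

(** * Colorability and the chromatic number *)

Lemma colorableW (G : sgraph) (k m : nat) :
  k <= m -> colorable G k -> colorable G m.
Proof.
move=> le_km /existsP[c /forallP c_proper]; apply/existsP.
exists [ffun x => widen_ord le_km (c x)].
apply/forallP => x; apply/forallP => y; apply/implyP => xy.
rewrite !ffunE -val_eqE /= val_eqE.
by move/forallP/(_ y)/implyP: (c_proper x); apply.
Qed.

Lemma chi_leq (G : sgraph) (k : nat) : (chi G <= k) = colorable G k.
Proof.
rewrite /chi; case: ex_minnP => m m_col m_min.
by apply/idP/idP => [/colorableW|/m_min //]; apply.
Qed.

(** * Colorings as families of color sets *)

Section ColorSets.
Variables (N k : nat) (H : sgraph) (f : H -> shift_graph N).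
Hypothesis f_adj : forall x y, adj x y = adj (f x) (f y).

(** The color of a pair [(x, y)] lies in [S x] but not in [S y], since a pair starting at [y] is
    adjacent to it. Conversely, coloring [(x, y)] by any element of [S x :\: S y] is proper. The map
    [f] serves the whole graph and the vertex-deleted one alike. *)
Lemma colorable_color_sets :
  colorable H k <->
  exists S : nat -> {set 'I_k},
    forall u, ~~ (S (vfst (f u)) \subset S (vsnd (f u))).
Proof.
split=> [/existsP[c /forallP c_proper]|[S S_f]].
  exists (fun x => [set i | [exists u, (vfst (f u) == x) && (c u == i)]]) => u.
  apply/subsetPn; exists (c u).
    by rewrite inE; apply/existsP; exists u; rewrite !eqxx.
  rewrite inE; apply/existsP => -[w /andP[/eqP w_u /eqP c_wu]].
  move/forallP/(_ w)/implyP: (c_proper u).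
  by rewrite f_adj /= /shift_adj w_u eqxx c_wu eqxx => /(_ isT).
have Sc u : exists i, i \in S (vfst (f u)) :\: S (vsnd (f u)).
  by case/subsetPn: (S_f u) => i iS iS'; exists i; rewrite inE iS' iS.
apply/existsP; exists [ffun u => xchoose (Sc u)].
apply/forallP => u; apply/forallP => w; apply/implyP.
rewrite f_adj !ffunE /= /shift_adj.
have := xchooseP (Sc w); have := xchooseP (Sc u).
rewrite !inE => /andP[u2 u1] /andP[w2 w1].
case/orP => /eqP e; apply/eqP => cE.
  by move: u2; rewrite cE e w1.
by move: w2; rewrite -cE e u1.
Qed.

End ColorSets.

Section Vertices.
Variable N : nat.
Implicit Types v u : shift_graph N.

Lemma shift_vertex_bounds v : [&& 0 < vfst v, vfst v < vsnd v & vsnd v <= N].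
Proof.
case/andP: (valP v) => v0 v12; apply/and3P; split=> //.
exact: (ltn_ord (val v).2).
Qed.

Lemma exists_shift_vertex (i j : nat) :
  [&& 0 < i, i < j & j <= N] -> exists v, vfst v = i /\ vsnd v = j.
Proof.
case/and3P=> i0 ij jN.
have iN : i < N.+1 by lia.
have jN1 : j < N.+1 by lia.
pose p : 'I_N.+1 * 'I_N.+1 := (Ordinal iN, Ordinal jN1).
have pP : (0 < p.1) && (p.1 < p.2) by rewrite /= i0.
by exists (Sub p pP : shift_vertex N).
Qed.

Lemma shift_vertex_inj v u : vfst v = vfst u -> vsnd v = vsnd u -> v = u.
Proof.
move=> e1 e2; apply: val_inj.
move: e1 e2; rewrite /vfst /vsnd.
by case: (val v) (val u) => [x y] [z t] /= /val_inj-> /val_inj->.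
Qed.

Lemma colorable_shift_graph (k : nat) :
  colorable (shift_graph N) k <->
  exists S : nat -> {set 'I_k},
    forall i j, [&& 0 < i, i < j & j <= N] -> ~~ (S i \subset S j).
Proof.
rewrite (colorable_color_sets _ k _ (@id (shift_graph N))) //.
split=> -[S SP]; exists S.
  by move=> i j /exists_shift_vertex[v [<- <-]].
by move=> v; apply/SP/shift_vertex_bounds.
Qed.

Lemma colorable_del_shift_graph v (k : nat) :
  colorable (del_vertex v) k <->
  exists S : nat -> {set 'I_k},
    forall i j, [&& 0 < i, i < j & j <= N] -> (i, j) != (vfst v, vsnd v) ->
      ~~ (S i \subset S j).
Proof.
rewrite (colorable_color_sets _ k (del_vertex v) val) //.
split=> -[S SP]; exists S.
  move=> i j /exists_shift_vertex[u [<- <-]] uv.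
  have neq_uv : u != v by apply: contraNneq uv => ->.
  exact: (SP (exist _ u neq_uv)).
move=> [u /= neq_uv]; apply: SP; first exact: shift_vertex_bounds.
by apply: contraNneq neq_uv => -[e1 e2]; apply/eqP/shift_vertex_inj.
Qed.

End Vertices.

(** * Counting and ordering the subsets of a finite type *)

Section CardSets.
Variable T : finType.
Implicit Types A B : {set T}.

(** Complementation exchanges the supersets of [A] with the subsets of [~: A]. *)
Lemma card_supersets A : #|[set B : {set T} | A \subset B]| = 2 ^ (#|T| - #|A|).
Proof.
rewrite -(cardsC A) addKn -card_powerset -(card_imset _ (@setC_inj T)).
congr #|pred_of_set _|; apply/setP => B; rewrite powersetE.
apply/imsetP/idP => [[C CA ->]|BA]; first by rewrite inE setCS in CA *.
by exists (~: B); rewrite ?setCK // inE -setCS setCK.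
Qed.

Lemma card_set_type : #|{: {set T}}| = 2 ^ #|T|.
Proof. by rewrite -[LHS]cardsT -powersetT card_powerset cardsT. Qed.

Lemma exists_set_card (k : nat) : k <= #|T| -> exists A, #|A| = k.
Proof.
move=> kT; exists [set:: take k (enum T)].
rewrite cardsE (card_uniqP _) ?take_uniq ?enum_uniq //.
by rewrite size_takel -?cardE.
Qed.

Definition noninclusion : rel {set T} := fun A B => ~~ (A \subset B).

Definition sets_by_card : seq {set T} :=
  sort (fun A B => #|B| <= #|A|) (enum {set T}).

(** A set included in one of at most its own cardinality equals it, and the list has no
    repetition. *)
Lemma pairwise_sets_by_card : pairwise noninclusion sets_by_card.
Proof.
have trans_ge : transitive (fun A B => #|B| <= #|A|).
  by move=> B A C BA CB; apply: leq_trans CB BA.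
have /[!(sorted_pairwise trans_ge)] ge_s :
    sorted (fun A B => #|B| <= #|A|) sets_by_card.
  by apply: sort_sorted => A B; apply: leq_total.
have neq_s : pairwise (fun A B => A != B) sets_by_card.
  by rewrite -uniq_pairwise sort_uniq enum_uniq.
have : pairwise [rel A B : {set T} | (A != B) && (#|B| <= #|A|)] sets_by_card.
  by rewrite pairwise_relI neq_s.
apply: sub_pairwise => A B /= /andP[neq_AB leBA].
by apply: contra neq_AB => AB; rewrite eqEcard AB.
Qed.

Lemma size_filter_sets_by_card (P : pred {set T}) :
  size [seq A <- sets_by_card | P A] = #|[set A | P A]|.
Proof.
by rewrite size_filter count_sort cardsE cardE enumT /enum_mem size_filter.
Qed.

Lemma size_sets_by_card : size sets_by_card = 2 ^ #|T|.
Proof. by rewrite size_sort -cardE card_set_type. Qed.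

End CardSets.

(** A repeated color set would be an inclusion, so the [N] sets are distinct subsets of [k] colors.
    Conversely, the subsets listed by decreasing cardinality form a valid family. *)
Lemma shift_graph_colorable (N k : nat) :
  colorable (shift_graph N) k = (N <= 2 ^ k).
Proof.
apply/idP/idP => [/colorable_shift_graph[S SP]|Nk].
  have S_inj : injective (fun i : 'I_N => S i.+1).
    move=> i j Sij; apply/val_inj => /=.
    case: (ltngtP i j) => // ltij.
      have := SP i.+1 j.+1; rewrite Sij subxx; case/(_ _)/negP => //.
      by rewrite /= ltnS ltij ltn_ord.
    have := SP j.+1 i.+1; rewrite Sij subxx; case/(_ _)/negP => //.
    by rewrite /= ltnS ltij ltn_ord.
  by have := leq_card _ S_inj; rewrite card_ord card_set_type card_ord.
apply/colorable_shift_graph.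
(* Integers start at 1 and list positions at 0; the default [set0] is never reached for indices up
   to [N]. *)
exists (fun i => nth set0 (sets_by_card 'I_k) i.-1) => i j /and3P[i0 ij jN].
apply: (pairwiseP set0 (pairwise_sets_by_card 'I_k)); rewrite ?inE.
- by rewrite size_sets_by_card card_ord; lia.
- by rewrite size_sets_by_card card_ord; lia.
- by lia.
Qed.

(** * Color sets when one pair is dropped *)

Section Criticality.
Variables (n a b : nat).
Hypothesis ab_bounds : [&& 0 < a, a < b & b <= 2 ^ n + 1].

Lemma color_sets_interval (S : nat -> {set 'I_n}) :
  (forall i j, [&& 0 < i, i < j & j <= 2 ^ n + 1] -> (i, j) != (a, b) ->
     ~~ (S i \subset S j)) ->
  exists2 l, l <= n & (2 ^ l <= a) && (b <= 2 ^ n - 2 ^ (n - l) + 2).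
Proof.
move: ab_bounds; set N := 2 ^ n + 1 => /and3P[a0 ab bN] SP.
have S_sub i j : 0 < i <= N -> 0 < j <= N -> S i \subset S j ->
    [\/ j < i, i = j | i = a /\ j = b].
  move=> iN jN Sij; case: (ltngtP i j) => ij;
    [constructor 3 | by constructor 1 | by constructor 2].
  have iNj : [&& 0 < i, i < j & j <= N] by lia.
  by have := contraTT (SP i j iNj) Sij => /eqP[-> ->].
(* Without [x] the exceptional pair is gone, so the [2 ^ n] remaining indices carry distinct sets
   and hence every subset of the colors. *)
have S_onto (x : nat) (Y : {set 'I_n}) : x = a \/ x = b ->
    exists2 i, (0 < i <= N) && (i != x) & S i = Y.
  move=> xab.
  pose D := [set i : 'I_N.+1 | (0 < i) && (i != x :> nat)].
  have xN : x < N.+1 by lia.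
  have cardD : #|D| = 2 ^ n.
    have -> : D = ~: [set ord0; Ordinal xN].
      by apply/setP => i; rewrite !inE negb_or lt0n -!val_eqE.
    rewrite cardsCs setCK cards2 card_ord -val_eqE /=.
    have -> : 0 != x by lia.
    by rewrite /N; lia.
  have S_inj : {in D &, injective (fun i : 'I_N.+1 => S i)}.
    move=> i j; rewrite !inE => /andP[i0 ix] /andP[j0 jx] Sij.
    have iN : 0 < i <= N by rewrite i0 -ltnS ltn_ord.
    have jN : 0 < j <= N by rewrite j0 -ltnS ltn_ord.
    apply: val_inj => /=.
    have Hij := S_sub i j iN jN; rewrite Sij subxx in Hij.
    have Hji := S_sub j i jN iN; rewrite -Sij subxx in Hji.
    by case: (Hij isT) => [||[]]; case: (Hji isT) => [||[]]; lia.
  have S_D : [set S (i : 'I_N.+1) | i in D] = setT.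
    apply/eqP; rewrite eqEcard subsetT card_in_imset // cardD.
    by rewrite cardsT card_set_type card_ord leqnn.
  have : Y \in [set: {set 'I_n}] by rewrite inE.
  rewrite -S_D => /imsetP[i]; rewrite inE => /andP[i0 ix] ->.
  by exists (i : nat); rewrite // i0 -ltnS ltn_ord.
(* The set [S a] also occurs at an index other than [a]; only the dropped pair can repeat a set, so
   this index is [b]. *)
have Sab : S a = S b.
  case: (S_onto a (S a)) => [|i /andP[iN ia] Sia]; first by left.
  have aN : 0 < a <= N by lia.
  have Hia := S_sub i a iN aN; rewrite Sia subxx in Hia.
  have Hai := S_sub a i aN iN; rewrite -Sia subxx in Hai.
  rewrite -Sia; congr S.
  by case: (Hia isT) => [||[]]; case: (Hai isT) => [||[]]; lia.
have leTn : #|S a| <= n by rewrite -[X in _ <= X]card_ord max_card.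
exists (n - #|S a|); first exact: leq_subr.
have card_range (lo hi : nat) (Q : {set {set 'I_n}}) :
    (forall Y, Y \in Q -> exists2 i, lo <= i <= hi & S i = Y) ->
    #|Q| <= hi.+1 - lo.
  move=> QS; rewrite -(size_iota lo (hi.+1 - lo)) -(size_map S) cardE.
  apply: uniq_leq_size; first exact: enum_uniq.
  move=> Y; rewrite mem_enum => /QS[i i_range <-].
  by apply: map_f; rewrite mem_iota; lia.
(* Each superset of [S a] occurs at an index other than [b], which noninclusion then forces into
   [[1, a]]. *)
have bound_a : 2 ^ (n - #|S a|) <= a.
  rewrite -{1}[n]card_ord -card_supersets -[X in _ <= X](subn1 a.+1).
  apply: card_range => Y; rewrite inE => TY.
  case: (S_onto b Y) => [|i /andP[iN ib] SiY]; first by right.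
  exists i => //; rewrite -SiY in TY.
  have aN : 0 < a <= N by lia.
  by case: (S_sub a i aN iN TY) => [||[]]; lia.
(* Dually, each subset of [S b] occurs at an index in [[b, N]]. *)
have bound_b : 2 ^ #|S a| <= N.+1 - b.
  rewrite -card_powerset; apply: card_range => Y.
  rewrite powersetE => TY.
  case: (S_onto a Y) => [|i /andP[iN ia] SiY]; first by left.
  exists i => //; rewrite -SiY Sab in TY.
  have bN' : 0 < b <= N by lia.
  by case: (S_sub i b iN bN' TY) => [||[]]; lia.
rewrite subKn // bound_a /=; move: bound_b (leq_pexp2l (isT : 0 < 2) leTn).
by rewrite /N; move: (2 ^ #|S a|) (2 ^ n) (expn_gt0 2 #|S a|) => x y; lia.
Qed.

Lemma interval_color_sets (l : nat) :
  l <= n -> 2 ^ l <= a -> b <= 2 ^ n - 2 ^ (n - l) + 2 ->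
  exists S : nat -> {set 'I_n},
    forall i j, [&& 0 < i, i < j & j <= 2 ^ n + 1] -> (i, j) != (a, b) ->
      ~~ (S i \subset S j).
Proof.
move=> ln la lb; case/and3P: (ab_bounds) => a0 ab bN.
have [T cardT] : exists T : {set 'I_n}, #|T| = n - l.
  by apply: exists_set_card; rewrite card_ord leq_subr.
pose s := sets_by_card 'I_n.
pose U := [seq Y : {set 'I_n} <- s | T \proper Y].
pose D := [seq Y : {set 'I_n} <- s | Y \proper T].
pose L := [seq Y : {set 'I_n} <- s | ~~ (T \subset Y) && ~~ (Y \subset T)].
have sizeU : (size U).+1 = 2 ^ l.
  rewrite size_filter_sets_by_card.
  have := card_supersets _ T; rewrite cardT card_ord subKn // => <-.
  rewrite [RHS](cardsD1 T) inE subxx add1n; congr _.+1.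
  congr #|pred_of_set _|; apply/setP => Y.
  by rewrite !inE properEneq eq_sym.
have sizeD : (size D).+1 = 2 ^ (n - l).
  rewrite size_filter_sets_by_card -cardT -card_powerset.
  rewrite (cardsD1 T (powerset T)) inE subxx add1n; congr _.+1.
  congr #|pred_of_set _|; apply/setP => Y.
  by rewrite !inE properEneq.
have sizeULD : size U + size L + size D = (2 ^ n).-1.
  have <- : size s = 2 ^ n by rewrite size_sets_by_card card_ord.
  rewrite /U /L /D !size_filter.
  have : count (pred1 T) s = 1.
    rewrite count_uniq_mem ?sort_uniq ?enum_uniq //.
    by rewrite mem_sort mem_enum.
  (* Every set falls into exactly one of four classes relative to [T]. *)
  have : count (pred1 T) s + (count (fun Y : {set 'I_n} => T \proper Y) s
    + count (fun Y : {set 'I_n} => ~~ (T \subset Y) && ~~ (Y \subset T)) s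
    + count (fun Y : {set 'I_n} => Y \proper T) s) = size s; last by lia.
  elim: s {U D L sizeU sizeD} => //= Y s IH.
  rewrite -IH !properE [Y == T]eqEsubset.
  by case: (Y \subset T); case: (T \subset Y) => /=; lia.
(* As [U] has [2 ^ l - 1] elements, [k] more sets bring the first [T] to position [a.-1], and [m]
   sets between the copies bring the second to [b.-1]. *)
pose k := a - 2 ^ l; pose m := (b - a).-1.
pose A := U ++ take k L; pose B := take m (drop k L).
pose C := drop m (drop k L) ++ D.
(* Noninclusion relaxed to tolerate the two copies of [T], the only failure in the list. *)
pose r : rel {set 'I_n} := fun X Y =>
  (X == T) && (Y == T) || noninclusion _ X Y.
have pw_noninc P : pairwise r [seq Y <- s | P Y].
  apply: (subseq_pairwise (filter_subseq _ _)).
  apply: sub_pairwise (pairwise_sets_by_card 'I_n) => X Y XY.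
  by rewrite /r XY orbT.
have memL X : X \in L -> ~~ (T \subset X) && ~~ (X \subset T).
  by rewrite mem_filter => /andP[].
have sL1 X : X \in take k L -> X \in L by apply: mem_take.
have sL2 X : X \in B -> X \in L by move/mem_take/mem_drop.
have sL3 X : X \in drop m (drop k L) -> X \in L by move/mem_drop/mem_drop.
(* Here and in [rLD] and [rUD] the inclusions are not strict, so that [T] itself can stand for a
   superset or a subset. *)
have rUL (X Y : {set 'I_n}) : T \subset X -> Y \in L -> r X Y.
  move=> TX /memL/andP[TY _]; rewrite /r /noninclusion.
  by rewrite (contra (subset_trans TX) TY) orbT.
have rLD (X Y : {set 'I_n}) : X \in L -> Y \subset T -> r X Y.
  move=> /memL/andP[_ XT] YT; rewrite /r /noninclusion.
  by rewrite (contra (fun XY => subset_trans XY YT) XT) orbT.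
have rUD (X Y : {set 'I_n}) : T \subset X -> Y \subset T -> r X Y.
  move=> TX YT; rewrite /r /noninclusion; case XY: (X \subset Y); last first.
    by rewrite orbT.
  rewrite orbF !eqEsubset TX YT /= andbT.
  by rewrite (subset_trans XY YT) (subset_trans TX XY).
have memU X : X \in U -> T \subset X.
  by rewrite mem_filter => /andP[/proper_sub].
have memD X : X \in D -> X \subset T.
  by rewrite mem_filter => /andP[/proper_sub].
have pwL : pairwise r (take k L ++ B ++ drop m (drop k L)).
  by rewrite !cat_take_drop; apply: pw_noninc.
have pwS : pairwise r (A ++ T :: B ++ T :: C).
  have pwU : pairwise r U := pw_noninc _.
  have pwD : pairwise r D := pw_noninc _.
  move: pwL; rewrite !pairwise_cat allrel_catr.
  case/and3P=> /andP[r12 r13] p1 /and3P[r23 p2 p3].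
  rewrite !(pairwise_cat, pairwise_cons, allrel_catl, allrel_catr,
    allrel_consl, allrel_consr, all_cat) /= !all_cat.
  rewrite pwU pwD r12 r13 r23 p1 p2 p3 /=.
  repeat (apply/andP; split); rewrite //;
    first [apply/allrelP => X Y hX hY | apply/allP => X hX | idtac];
    first [by apply: rUL; auto | by apply: rLD; auto | by apply: rUD; auto].
have sizeA : size A = a.-1 by rewrite size_cat size_takel /k; lia.
(* The upper bound on [b] says exactly that [k + m <= size L]. *)
have sizeB : size B = m by rewrite size_takel // size_drop /k /m; lia.
have sizeS : size (A ++ T :: B ++ T :: C) = 2 ^ n + 1.
  rewrite size_cat /= size_cat /= sizeA sizeB size_cat !size_drop /k /m.
  by have := expn_gt0 2 n; lia.
have TnotL : T \notin L by apply/negP => /memL; rewrite subxx.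
have nth_T i : i < 2 ^ n + 1 -> nth T (A ++ T :: B ++ T :: C) i = T ->
    i = a.-1 \/ i = b.-1.
  rewrite -sizeS size_cat /= size_cat /= => iS.
  rewrite nth_cat; case: ltnP => [iA|Ai].
    move=> nthT; have := mem_nth T iA.
    rewrite nthT mem_cat mem_filter properxx /= => /sL1.
    by rewrite (negPf TnotL).
  case iE: (i - size A) => [|p] /=; first by left; lia.
  rewrite nth_cat; case: ltnP => [pB|Bp].
    by move=> nthT; have := sL2 _ (mem_nth T pB); rewrite nthT (negPf TnotL).
  case pE: (p - size B) => [|q] /=; first by right; rewrite /m in sizeB; lia.
  have qC : q < size C by lia.
  move=> nthT; have := mem_nth T qC.
  rewrite nthT mem_cat mem_filter properxx orbF => /sL3.
  by rewrite (negPf TnotL).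
exists (fun i => nth T (A ++ T :: B ++ T :: C) i.-1) => i j ijN ij_ab.
have i1 : i.-1 < 2 ^ n + 1 by lia.
have j1 : j.-1 < 2 ^ n + 1 by lia.
have ij1 : i.-1 < j.-1 by lia.
have := pairwiseP T pwS i.-1 j.-1; rewrite !inE sizeS => /(_ i1 j1 ij1).
(* In the tolerated case both positions hold [T], so [i < j] leaves only the dropped pair. *)
case/orP => // /andP[/eqP /(nth_T _ i1) iab /eqP /(nth_T _ j1) jab].
by case/eqP: ij_ab; congr pair; lia.
Qed.

End Criticality.

Theorem theorem3 (n : nat) (hn : 2 <= n) (v : shift_graph (2 ^ n + 1)) :
  chi (del_vertex v) < chi (shift_graph (2 ^ n + 1)) <-> v \in W n.
Proof.
have v_bounds := shift_vertex_bounds _ v.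
(* This is [2 ^ n < 2 ^ n + 1 <= 2 ^ n.+1]. *)
have chi_shift : chi (shift_graph (2 ^ n + 1)) = n.+1.
  apply/eqP; rewrite eqn_leq chi_leq shift_graph_colorable.
  rewrite ltnNge chi_leq shift_graph_colorable addn1 ltnn andbT expnS.
  by have := expn_gt0 2 n; lia.
rewrite chi_shift ltnS chi_leq inE; split.
  case/colorable_del_shift_graph => S SP.
  have [l ln /andP[la lb]] := color_sets_interval _ _ _ v_bounds _ SP.
  apply/existsP; exists (Ordinal (ln : l < n.+1)).
  rewrite !inE /=; move: v_bounds la lb; lia.
case/existsP=> l; rewrite !inE => /andP[/andP[la _] /andP[_ lb]].
apply/colorable_del_shift_graph.
exact: interval_color_sets v_bounds _ (ltn_ord l) la lb.
Qed.
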